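(* Let $G$ be a group (written additively), $k$ a field, $\chi:G\to k^\times$ a character, and $\mathcal C$ a $G$-hom-graded category. Suppose $(\mathbb S,\ell,\kappa)$ is a $\chi$-hom-graded Serre structure for $\mathcal C$. Let $\mathcal D=\mathcal C\# G$ be the smash product with its $G$-action $F$. Define $\mathbb S^{\mathcal D}:\mathcal D\to\mathcal D$ by $\mathbb S^{\mathcal D}(x^p)=(\mathbb Sx)^{p+\ell(x)}$ on objects and by $\mathbb S$ on morphisms; this functor strictly commutes with the $G$-action, and $\mathrm{id}$ denotes the family of identity natural transformations between $F^p\mathbb S^{\mathcal D}$ and $\mathbb S^{\mathcal D}F^p$, $p\in G$. Define $$\kappa^{\mathcal D}_{x^p,y^q}=\chi(p)\kappa_{x,y}:\ \mathcal D(x^p,y^q)=\mathcal C^{q-p}(x,y)\to\mathcal C^{q-p-\ell(x)}(y,\mathbb Sx)^*=\mathcal D(y^q,\mathbb S^{\mathcal D}x^p)^*.$$ Then $(\mathbb S^{\mathcal D},\mathrm{id},\kappa^{\mathcal D})$ is a $\chi$-equivariant Serre structure on $(\mathcal C\#G,F)$.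
   Context: All categories and functors are $k$-linear; $V^*=\mathrm{Hom}_k(V,k)$. A $G$-hom-graded category has $G$-graded hom spaces $\mathcal C(x,y)=\bigoplus_{p\in G}\mathcal C^p(x,y)$, with composition respecting the grading. $\mathcal C^p(x,y)^*$ denotes the degree $p$ part of the graded dual, that is $(\mathcal C^{-p}(x,y))^*$. $\chi$-hom-graded Serre structure on a $G$-hom-graded category $\mathcal C$ with finite-dimensional graded pieces: a triple $(\mathbb S,\ell,\kappa)$ where $\mathbb S$ is an autoequivalence, $\ell:\mathrm{ob}\,\mathcal C\to G$, with $\deg\mathbb S(f)=\deg f+\ell(y)-\ell(x)$ for homogeneous $f:x\to y$, and $\kappa_{x,y}:\mathcal C(x,y)\to\mathcal C(y,\mathbb Sx)^*$ are isomorphisms with $\kappa(hg)(u)=\chi(\deg h)\kappa(g)(uh)$, $\kappa(gf)(u)=\kappa(g)(\mathbb S(f)u)$ for homogeneous composable morphisms, restricting to isomorphisms $\mathcal C^p(x,y)\to\mathcal C^{p-\ell(x)}(y,\mathbb Sx)^*$. Smash product $\mathcal C\#G$: objects $x^p$ with $x\in\mathrm{ob}\,\mathcal C$, $p\in G$; morphisms $\mathcal C\#G(x^p,y^q)=\mathcal C^{q-p}(x,y)$; composition as in $\mathcal C$; $G$-action $F^r(x^p)=x^{p+r}$, acting on morphisms as the identity of $\mathcal C^{q-p}(x,y)$. Serre structure on a $k$-linear category $\mathcal D$: $(\mathbb S,\kappa)$ with $\mathbb S$ an autoequivalence and isomorphisms $\kappa_{x,y}:\mathcal D(x,y)\to\mathcal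 D(y,\mathbb Sx)^*$ with $\kappa(hg)(u)=\kappa(g)(uh)$ and $\kappa(gf)(u)=\kappa(g)(\mathbb S(f)u)$. For an automorphism $E$, $\zeta_E:\mathbb SE\to E\mathbb S$ is the canonical natural isomorphism characterised by $\kappa_{Ey,x}(e)(u)=\kappa_{y,E^{-1}x}(E^{-1}e)(E^{-1}(\zeta_{E,y}u))$ for $e\in\mathcal D(Ey,x)$, $u\in\mathcal D(x,\mathbb SEy)$. A $\chi$-equivariant Serre structure on $(\mathcal D,F)$ is a triple $(\mathbb S,s,\kappa)$ with $(\mathbb S,\kappa)$ a Serre structure and $s=(s^p)_{p\in G}$, $s^p=\chi(p)\zeta_{F^p}:\mathbb SF^p\to F^p\mathbb S$.
   Formalization: The pairing on the smash product uses χ(-q)κ instead of χ(p)κ, for which the Serre identity fails; the autoequivalence S is required to have a quasi-inverse with homogeneous unit and counit, without which S^D may not be dense; G is taken abelian. *)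

(* Defs.v *)
From HB Require Import structures.
From mathcomp Require Import all_boot all_algebra.
From mathcomp Require Import boolp.

Set Implicit Arguments.
Unset Strict Implicit.
Unset Printing Implicit Defensive.

Import GRing.Theory.
Local Open Scope ring_scope.

Section LinearCategories.
Variable k : fieldType.

Record linCat := LinCat {
  ob :> Type;
  mor : ob -> ob -> lmodType k;
  idm : forall x, mor x x;
  mcomp : forall x y z, mor y z -> mor x y -> mor x z;
  comp_linearl : forall x y z (f : mor x y), linear (fun g : mor y z => mcomp g f);
  comp_linearr : forall x y z (g : mor y z), linear (@mcomp x y z g);
  comp1m : forall x y (f : mor x y), mcomp (idm y) f = f;
  compm1 : forall x y (f : mor x y), mcomp f (idm x) = f;
  compA : forall w x y z (h : mor y z) (g : mor x y) (f : mor w x),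
    mcomp h (mcomp g f) = mcomp (mcomp h g) f
}.

Definition invertible (C : linCat) (x y : C) (f : mor x y) : Prop :=
  exists g : mor y x, mcomp g f = idm x /\ mcomp f g = idm y.

Record linFunctor (C D : linCat) := LinFunctor {
  fob :> C -> D;
  fmap : forall x y : C, mor x y -> mor (fob x) (fob y);
  fmap_linear : forall x y, linear (@fmap x y);
  fmap1 : forall x, fmap (idm x) = idm (fob x);
  fmapM : forall x y z (g : mor y z) (f : mor x y),
    fmap (mcomp g f) = mcomp (fmap g) (fmap f)
}.

Definition functor_eq_ob (C D : linCat) (F H : linFunctor C D) (e : F = H) (x : C) :
  F x = H x := congr1 (fun K : linFunctor C D => K x) e.

(* Transport of a morphism along equalities of its endpoints. *)
Definition hom_cast (C : linCat) (x x' y y' : C) (ex : x = x') (ey : y = y')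
    (f : mor x y) : mor x' y' :=
  eq_rect y (fun b => mor x' b) (eq_rect x (fun a => mor a y) f x' ex) y' ey.

Lemma functor_ext (C D : linCat) (F H : linFunctor C D) (e : forall x, F x = H x) :
  (forall x y (f : mor x y), hom_cast (e x) (e y) (fmap F f) = fmap H f) -> F = H.
Proof.
case: F H e => [F0 F1 Fl F1m FM] [H0 H1 Hl H1m HM] /= e.
have E : F0 = H0 by apply: functional_extensionality_dep.
subst H0 => eqF.
have E1 : F1 = H1.
  apply: functional_extensionality_dep => x.
  apply: functional_extensionality_dep => y.
  apply: functional_extensionality_dep => f.
  rewrite -eqF.
  by rewrite (Prop_irrelevance (e x) erefl) (Prop_irrelevance (e y) erefl).
subst H1; congr LinFunctor; exact: Prop_irrelevance.
Qed.

Definition functor_id (C : linCat) : linFunctor C C.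
Proof. by refine (@LinFunctor C C (fun x => x) (fun x y f => f) _ _ _). Defined.

Definition functor_comp (C D E : linCat) (F : linFunctor D E) (H : linFunctor C D) :
  linFunctor C E.
Proof.
refine (@LinFunctor C E (fun x => F (H x)) (fun x y f => fmap F (fmap H f)) _ _ _).
- by move=> x y a f g; rewrite !fmap_linear.
- by move=> x; rewrite !fmap1.
- by move=> x y z g f; rewrite !fmapM.
Defined.

(* The identity natural transformation between two functors that are equal. *)
Definition id_transf (C D : linCat) (F H : linFunctor C D) (e : F = H) (x : C) :
  mor (F x) (H x) := hom_cast erefl (functor_eq_ob e x) (idm (F x)).

Definition natural (C D : linCat) (F H : linFunctor C D)
    (a : forall x, mor (F x) (H x)) : Prop :=
  forall x y (f : mor x y), mcomp (a y) (fmap F f) = mcomp (fmap H f) (a x).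

Definition natural_iso (C D : linCat) (F H : linFunctor C D)
    (a : forall x, mor (F x) (H x)) : Prop :=
  natural a /\ forall x, invertible (a x).

Definition is_autoequivalence (C : linCat) (S : linFunctor C C) : Prop :=
  exists (T : linFunctor C C)
         (eta : forall x, mor (functor_id C x) (functor_comp T S x))
         (eps : forall x, mor (functor_comp S T x) (functor_id C x)),
    natural_iso eta /\ natural_iso eps.

Record is_serre (D : linCat) (S : linFunctor D D)
    (kappa : forall x y : D, mor x y -> {scalar mor y (S x)}) : Prop := IsSerre {
  serre_equiv : is_autoequivalence S;
  serre_linear : forall (x y : D) a (f g : mor x y) (u : mor y (S x)),
    kappa x y (a *: f + g) u = a * kappa x y f u + kappa x y g u;
  serre_bij : forall x y : D, bijective (kappa x y);
  serre_left : forall (x y z : D) (h : mor y z) (g : mor x y) (u : mor z (S x)),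
    kappa x z (mcomp h g) u = kappa x y g (mcomp u h);
  serre_right : forall (x y z : D) (g : mor y z) (f : mor x y) (u : mor z (S x)),
    kappa x z (mcomp g f) u = kappa y z g (mcomp (fmap S f) u)
}.

(* The automorphism [E] is given with its strict inverse [E']. The casts only
   identify the object E' (E y) with y and E' (E (S y)) with S y. *)
Definition is_zeta (D : linCat) (S : linFunctor D D)
    (kappa : forall x y : D, mor x y -> {scalar mor y (S x)})
    (E E' : linFunctor D D) (EK : functor_comp E' E = functor_id D)
    (zeta : forall y, mor (functor_comp S E y) (functor_comp E S y)) : Prop :=
  natural_iso zeta /\
  forall (x y : D) (e : mor (E y) x) (u : mor x (S (E y))),
    kappa (E y) x e u =
    kappa y (E' x)
      (hom_cast (functor_eq_ob EK y) erefl (fmap E' e))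
      (hom_cast erefl (functor_eq_ob EK (S y)) (fmap E' (mcomp (zeta y) u))).

End LinearCategories.

Section Gradings.
Variables (k : fieldType) (G : zmodType).

Definition is_character (chi : G -> k) : Prop :=
  (forall p, chi p != 0) /\ (forall p q, chi (p + q) = chi p * chi q).

Record gaction (D : linCat k) := GAction {
  gact :> G -> linFunctor D D;
  act0 : gact 0 = functor_id D;
  actD : forall p q, gact (p + q) = functor_comp (gact p) (gact q)
}.

Lemma actNK (D : linCat k) (F : gaction D) (p : G) :
  functor_comp (F (- p)) (F p) = functor_id D.
Proof. by rewrite -actD addNr act0. Qed.

Record is_equivariant_serre (chi : G -> k) (D : linCat k) (F : gaction D)
    (S : linFunctor D D)
    (s : forall (p : G) (y : D), mor (functor_comp S (F p) y) (functor_comp (F p) S y))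
    (kappa : forall x y : D, mor x y -> {scalar mor y (S x)}) : Prop :=
  IsEquivariantSerre {
  equivariant_serre : is_serre kappa;
  equivariant_zeta : forall p : G,
    exists zeta : forall y : D, mor (functor_comp S (F p) y) (functor_comp (F p) S y),
      is_zeta kappa (actNK F p) zeta /\ forall y, s p y = chi p *: zeta y
}.

(* The hom space is the internal direct sum of the subspaces [piece x y p]. *)
Record hgCat := HgCat {
  hcat :> linCat k;
  piece : forall x y : hcat, G -> {pred mor x y};
  piece_submod : forall (x y : hcat) p, submod_closed (@piece x y p);
  piece_sum : forall (x y : hcat) (f : mor x y),
    exists (s : seq G) (c : G -> mor x y),
      (forall p, c p \in @piece x y p) /\ f = \sum_(p <- s) c p;
  piece_direct : forall (x y : hcat) (s : seq G) (c : G -> mor x y), uniq s ->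
    (forall p, c p \in @piece x y p) -> \sum_(p <- s) c p = 0 ->
    forall p, p \in s -> c p = 0;
  piece1 : forall x : hcat, idm x \in @piece x x 0;
  pieceM : forall (x y z : hcat) p q (g : mor y z) (f : mor x y),
    g \in @piece y z q -> f \in @piece x y p -> mcomp g f \in @piece x z (q + p)
}.

Arguments piece {h} x y p : rename.

Definition fd_pieces (C : hgCat) : Prop :=
  forall (x y : C) (p : G), exists (n : nat) (b : 'I_n -> mor x y),
    (forall i, b i \in piece x y p) /\
    forall f, f \in piece x y p -> exists a : 'I_n -> k, f = \sum_i a i *: b i.

Record hgFunctor (C D : hgCat) := HgFunctor {
  hgfun :> linFunctor C D;
  adj : C -> G;
  hgfun_deg : forall (x y : C) p (f : mor x y), f \in piece x y p ->
    fmap hgfun f \in piece (hgfun x) (hgfun y) (p + adj y - adj x)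
}.

(* The natural isomorphisms exhibiting a quasi-inverse have homogeneous
   components: objects are identified only along homogeneous isomorphisms. *)
Definition is_hg_autoequivalence (C : hgCat) (S : linFunctor C C) : Prop :=
  exists (T : linFunctor C C)
         (eta : forall x, mor (functor_id C x) (functor_comp T S x))
         (eps : forall x, mor (functor_comp S T x) (functor_id C x)),
    [/\ natural_iso eta, natural_iso eps,
        forall x, exists p, eta x \in piece _ _ p &
        forall x, exists p, eps x \in piece _ _ p].

(* The graded dual consists of the functionals vanishing on almost all pieces;
   an element of the dual of piece -p is extended by zero to the other pieces. *)
Definition in_gdual (C : hgCat) (x y : C) (phi : {scalar mor x y}) : Prop :=
  exists s : seq G, forall q u, q \notin s -> u \in piece x y q -> phi u = 0.

Definition in_gdual_deg (C : hgCat) (x y : C) (p : G) (phi : {scalar mor x y}) : Prop :=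
  forall q u, q != - p -> u \in piece x y q -> phi u = 0.

Record is_hg_serre (chi : G -> k) (C : hgCat) (S : hgFunctor C C)
    (kappa : forall x y : C, mor x y -> {scalar mor y (S x)}) : Prop := IsHgSerre {
  hg_serre_equiv : is_hg_autoequivalence S;
  hg_serre_linear : forall (x y : C) a (f g : mor x y) (u : mor y (S x)),
    kappa x y (a *: f + g) u = a * kappa x y f u + kappa x y g u;
  hg_serre_inj : forall x y : C, injective (kappa x y);
  hg_serre_im : forall (x y : C) (phi : {scalar mor y (S x)}),
    in_gdual phi <-> exists f, kappa x y f = phi;
  hg_serre_im_deg : forall (x y : C) p (phi : {scalar mor y (S x)}),
    in_gdual_deg (p - adj S x) phi <->
    exists2 f, f \in piece x y p & kappa x y f = phi;
  hg_serre_left : forall (x y z : C) p q r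
    (h : mor y z) (g : mor x y) (u : mor z (S x)),
    h \in piece y z p -> g \in piece x y q -> u \in piece z (S x) r ->
    kappa x z (mcomp h g) u = chi p * kappa x y g (mcomp u h);
  hg_serre_right : forall (x y z : C) p q r
    (g : mor y z) (f : mor x y) (u : mor z (S x)),
    g \in piece y z p -> f \in piece x y q -> u \in piece z (S x) r ->
    kappa x z (mcomp g f) u = kappa y z g (mcomp (fmap S f) u)
}.

End Gradings.

Arguments piece {k G h} x y p.

Section Homogeneous.
Variables (k : fieldType) (G : zmodType) (C : hgCat k G) (x y : C) (p : G).

Record homog := Homog { hval : mor x y; hvalP : hval \in piece x y p }.

HB.instance Definition _ := [isSub for hval].
HB.instance Definition _ := [Choice of homog by <:].

HB.instance Definition _ :=
  GRing.SubChoice_isSubLmodule.Build k (mor x y) (piece x y p) homog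
    (GRing.submod_closed_semi (piece_submod x y p)).

End Homogeneous.

Lemma piece_eq (k : fieldType) (G : zmodType) (C : hgCat k G) (x y : C) (p q : G)
  (f : mor x y) : p = q -> f \in piece x y p -> f \in piece x y q.
Proof. by move=> ->. Qed.

Section Smash.
Variables (k : fieldType) (G : zmodType) (C : hgCat k G).

(* The pair (x, p) is the object x^p. *)
Definition smash_ob : Type := (C * G)%type.

Definition smash_hom (X Y : smash_ob) : lmodType k := homog X.1 Y.1 (Y.2 - X.2).

Definition smash_id (X : smash_ob) : smash_hom X X :=
  Homog (piece_eq (esym (subrr X.2)) (piece1 X.1)).

Definition smash_comp (X Y Z : smash_ob) (g : smash_hom Y Z) (f : smash_hom X Y) :
    smash_hom X Z :=
  Homog (piece_eq (subrKA Y.2 Z.2 (- X.2)) (pieceM (hvalP g) (hvalP f))).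

Definition smash : linCat k.
Proof.
refine (@LinCat k smash_ob smash_hom smash_id smash_comp _ _ _ _ _).
- by move=> X Y Z f a g h; apply: val_inj; exact: comp_linearl.
- by move=> X Y Z g a f h; apply: val_inj; exact: comp_linearr.
- by move=> X Y f; apply: val_inj; exact: comp1m.
- by move=> X Y f; apply: val_inj; exact: compm1.
- by move=> W X Y Z h g f; apply: val_inj; exact: compA.
Defined.

Lemma shift_degE (p q r : G) : q - p = (q + r) - (p + r).
Proof. by rewrite (addrC p) addrKA. Qed.

Definition smash_shift (r : G) : linFunctor smash smash.
Proof.
refine (@LinFunctor k smash smash (fun X => (X.1, X.2 + r))
  (fun X Y f => Homog (piece_eq (shift_degE X.2 Y.2 r) (hvalP f))) _ _ _).
- by move=> X Y a f g; apply: val_inj.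
- by move=> X; apply: val_inj.
- by move=> X Y Z g f; apply: val_inj.
Defined.

Lemma hval_cast (x y : C) (p p' q q' : G)
    (ex : (x, p) = (x, p') :> smash) (ey : (y, q) = (y, q') :> smash)
    (f : mor ((x, p) : smash) ((y, q) : smash)) :
  hval (hom_cast ex ey f) = hval f.
Proof.
have [ep eq] : p = p' /\ q = q' by move: (ex) (ey) => [->] [->].
subst p' q'.
by rewrite (Prop_irrelevance ex erefl) (Prop_irrelevance ey erefl).
Qed.

Lemma smash_shift0 : smash_shift 0 = functor_id smash.
Proof.
have e (X : smash) : smash_shift 0 X = functor_id smash X.
  by case: X => x p; rewrite /= addr0.
apply: (functor_ext (e := e)) => -[x p] [y q] f.
by apply: val_inj; rewrite /= hval_cast.
Qed.

Lemma smash_shiftD (r s : G) :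
  smash_shift (r + s) = functor_comp (smash_shift r) (smash_shift s).
Proof.
have e (X : smash) : smash_shift (r + s) X = functor_comp (smash_shift r) (smash_shift s) X.
  by rewrite /= (addrC r) addrA.
apply: (functor_ext (e := e)) => -[x p] [y q] f.
by apply: val_inj; rewrite /= hval_cast.
Qed.

Definition smash_action : gaction G smash := GAction smash_shift0 smash_shiftD.

Section Functor.
Variable S : hgFunctor C C.

Lemma smash_degE (x y : C) (p q : G) :
  (q - p) + adj S y - adj S x = (q + adj S y) - (p + adj S x).
Proof. by rewrite opprD addrACA addrA. Qed.

Definition smash_functor : linFunctor smash smash.
Proof.
refine (@LinFunctor k smash smash (fun X => (S X.1, X.2 + adj S X.1))
  (fun X Y f => Homog (piece_eq (smash_degE X.1 Y.1 X.2 Y.2)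
                         (hgfun_deg S (hvalP f)))) _ _ _).
- by move=> X Y a f g; apply: val_inj; exact: fmap_linear.
- by move=> X; apply: val_inj; exact: fmap1.
- by move=> X Y Z g f; apply: val_inj; exact: fmapM.
Defined.

Section Pairing.
Variables (chi : G -> k).
Variable kappa : forall x y : C, mor x y -> {scalar mor y (S x)}.
Variables (X Y : smash) (f : mor X Y).

(* At objects x^p and y^q the scalar is chi (- q), with q the exponent of the
   target. With kappa (h g) u = chi (deg h) * kappa g (u h) the family
   c p q * kappa satisfies [serre_left] and [serre_right] only if
   c p r * chi (r - q) = c p q and c p r = c q r along nonzero pairings, which
   forces chi (- q) up to a constant. With chi p instead, [serre_left] fails for
   k[t]/(t^2), deg t = 1, chi n = (-1)^n, unless 2 = 0 in k. *)
Definition smash_pairing (u : mor Y (smash_functor X)) : k :=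
  chi (- Y.2) * kappa (hval f) (hval u).

Fact smash_pairing_linear : scalar smash_pairing.
Proof.
by move=> a u v; rewrite /smash_pairing linearP /= mulrDr mulrCA.
Qed.

HB.instance Definition _ :=
  GRing.isLinear.Build k (mor Y (smash_functor X)) k *%R smash_pairing
    smash_pairing_linear.

Definition smash_kappa : {scalar mor Y (smash_functor X)} := smash_pairing.

End Pairing.
End Functor.
End Smash.

Arguments smash_action {k G} C.

(* Main.v *)
Require Import Defs.
From HB Require Import structures.
From mathcomp Require Import all_boot all_algebra.
From mathcomp Require Import boolp.

Set Implicit Arguments.
Unset Strict Implicit.
Unset Printing Implicit Defensive.

Import GRing.Theory.
Local Open Scope ring_scope.

(** The smash product turns degrees into positions: a homogeneous morphism of
    degree q - p is a morphism x^p -> y^q. The statement therefore says that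
    everything in a graded Serre structure on C, read on homogeneous elements
    of the right degree, is a Serre structure on C#G, and that rescaling by chi
    absorbs the sign chi (deg h) of the graded structure.

    The identities are short computations with chi. The pairing at (x^p, y^q)
    carries the scalar chi (- q). In [serre_left] the scalars at the targets y^q
    and z^r differ by chi (r - q), which is chi (deg h); in [serre_right] both
    sides have the same target. For the equivariance, moving the target by - p
    multiplies the scalar by chi p, so the natural isomorphism zeta attached to
    the shift by p has to be chi (p)^-1 times the identity ([smash_is_zeta]),
    and chi p * zeta is the identity.

    The substance lies in two transfers from C to C#G.

    Autoequivalence ([smash_functor_autoequivalence]). The unit and counit that
    exhibit a quasi-inverse T of S are homogeneous, but no triangle identity
    relates them, so the degree of the unit at x need not be the one
    required in C#G. So only the counit eps is kept: S is fully faithful on C,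
    hence on C#G because S reflects degrees ([piece_reflect]), and
    eps : S (T x) -> x, of degree d, shows that x^p is isomorphic to the image
    of (T x)^(p - d - l (T x)). A fully faithful, essentially surjective functor
    is an autoequivalence ([fully_faithful_autoequivalence]).

    Nondegeneracy ([smash_kappa_bij]). A functional on a single piece of
    C(y, S x), extended by zero to the other pieces, lies in one degree of the
    graded dual, so it comes from a unique f, homogeneous of the matching
    degree.

    Both transfers need the projections of a hom space onto its pieces, which
    are built from the existence and uniqueness of homogeneous decompositions
    ([component]). *)

(** * Finite sums and linear maps *)

Lemma sum_support (V : nmodType) (I : eqType) (s t : seq I) (c : I -> V) :
  uniq s -> uniq t -> {subset s <= t} -> (forall p, p \notin s -> c p = 0) ->
  \sum_(p <- t) c p = \sum_(p <- s) c p.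
Proof.
move=> us ut st c0.
rewrite -(@big_rmcond_in _ _ _ _ t (mem s)); last by move=> p _ /c0.
rewrite -big_filter; apply/perm_big/uniq_perm; rewrite ?filter_uniq// => p.
by rewrite mem_filter /=; case: (boolP (p \in s)) => // /st ->.
Qed.

Lemma scalar_ext (k : fieldType) (V : lmodType k) (phi psi : {scalar V}) :
  phi =1 psi -> phi = psi.
Proof.
move: phi psi => [f [[fa] [fs]]] [g [[ga] [gs]]] /= /funext E; subst g.
by rewrite (Prop_irrelevance fa ga) (Prop_irrelevance fs gs).
Qed.

HB.instance Definition _ (k : fieldType) (C D : linCat k) (F : linFunctor C D)
    (x y : C) :=
  GRing.isLinear.Build k (mor x y) (mor (F x) (F y)) *:%R (@fmap k C D F x y)
    (@fmap_linear k C D F x y).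

HB.instance Definition _ (k : fieldType) (C : linCat k) (x y z : C) (g : mor y z) :=
  GRing.isLinear.Build k (mor x y) (mor x z) *:%R (mcomp g) (comp_linearr g).

(** Composition with a fixed first factor gets a name so that it can carry the
    structure of a linear map. *)
Definition precomp (k : fieldType) (C : linCat k) (x y z : C) (f : mor x y)
  (g : mor y z) : mor x z := mcomp g f.

HB.instance Definition _ (k : fieldType) (C : linCat k) (x y z : C) (f : mor x y) :=
  GRing.isLinear.Build k (mor y z) (mor x z) *:%R (precomp f) (comp_linearl f).

Lemma mcompZl (k : fieldType) (C : linCat k) (x y z : C) a (g : mor y z)
  (f : mor x y) : mcomp (a *: g) f = a *: mcomp g f.
Proof. exact: (linearZ_LR (precomp f)). Qed.

Lemma mcompZr (k : fieldType) (C : linCat k) (x y z : C) a (g : mor y z)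
  (f : mor x y) : mcomp g (a *: f) = a *: mcomp g f.
Proof. exact: (linearZ_LR (mcomp g)). Qed.

(** * Homogeneous components *)

Section Homog.
Variables (k : fieldType) (G : zmodType).

Section Hom.
Variables (C : hgCat k G) (x y : C).
Implicit Types (f g : mor x y) (c : G -> mor x y).

(** The family c is defined on all of G and vanishes outside a finite list, so
    that two decompositions of f are compared pointwise, whatever the lists. *)
Definition decomp f c := (forall p, c p \in piece x y p) /\
  exists s : seq G,
    [/\ uniq s, forall p, p \notin s -> c p = 0 & f = \sum_(p <- s) c p].

(** The list given by [piece_sum] may repeat a degree, which multiplies the
    corresponding term by its number of occurrences. *)
Lemma decomp_ex f : exists c, decomp f c.
Proof.
have [s [c [cP ->]]] := piece_sum f.
exists (fun p => c p *+ count_mem p s); split=> [p|].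
  have [P0 PD] := piece_submod x y p.
  elim: (count_mem p s) => [|n IH]; first by rewrite mulr0n.
  by rewrite mulrS -[c p in X in X + _]scale1r PD.
exists (undup s); split; first exact: undup_uniq.
- by move=> p; rewrite mem_undup => /count_memPn ->.
by rewrite -big_undup_iterop_count.
Qed.

Lemma decomp_linear a f g c d :
  decomp f c -> decomp g d -> decomp (a *: f + g) (fun p => a *: c p + d p).
Proof.
move=> [cP [s [us c0 ->]]] [dP [t [ut d0 ->]]]; split=> [p|].
  exact: (piece_submod x y p).2.
exists (undup (s ++ t)); split; first exact: undup_uniq.
- move=> p; rewrite mem_undup mem_cat negb_or => /andP[/c0 -> /d0 ->].
  by rewrite scaler0 addr0.
rewrite big_split -scaler_sumr; congr (_ *: _ + _); apply/esym/sum_support;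
  rewrite ?undup_uniq// => p pin; rewrite mem_undup mem_cat pin ?orbT//.
Qed.

Lemma decomp0 c : decomp 0 c -> forall p, c p = 0.
Proof.
move=> [cP [s [us c0 /esym E]]] p.
have [ps|/c0//] := boolP (p \in s).
exact: (piece_direct us cP E).
Qed.

Lemma decomp_uniq f c d : decomp f c -> decomp f d -> c =1 d.
Proof.
move=> fc fd p; have := decomp_linear (-1) fd fc.
rewrite scaleN1r addNr => /decomp0 /(_ p)/eqP.
by rewrite scaleN1r addrC subr_eq0 => /eqP.
Qed.

Definition component f : G -> mor x y := projT1 (cid (decomp_ex f)).

Lemma componentP f : decomp f (component f).
Proof. exact: projT2 (cid (decomp_ex f)). Qed.

Lemma component_in f p : component f p \in piece x y p.
Proof. exact: (componentP f).1. Qed.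

Lemma component_sum f : exists s : seq G, f = \sum_(p <- s) component f p.
Proof. by have [_ [s [_ _ E]]] := componentP f; exists s. Qed.

Lemma component_linear p : linear (fun f => component f p).
Proof.
move=> a f g.
exact: decomp_uniq (componentP _) (decomp_linear a (componentP f) (componentP g)) p.
Qed.

Lemma component_piece p f : f \in piece x y p ->
  forall q, component f q = if q == p then f else 0.
Proof.
move=> fP; have fD : decomp f (fun q => if q == p then f else 0).
  split=> [q|]; first by case: eqP => [->//|_]; exact: (piece_submod x y q).1.
  exists [:: p]; split=> // [q|]; first by rewrite inE => /negbTE ->.
  by rewrite big_seq1 eqxx.
exact: decomp_uniq (componentP f) fD.
Qed.

Lemma piece_component p f : (forall q, q != p -> component f q = 0) -> f \in piece x y p.
Proof.
move=> f0; have [s ->] := component_sum f; have [P0 PD] := piece_submod x y p.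
apply: (big_ind (fun g => g \in piece x y p)) => //; first by move=> g h gP hP; rewrite -[g]scale1r PD.
move=> q _; have [->|/f0 ->//] := eqVneq q p; exact: component_in.
Qed.

Lemma scalar_piece_ext (phi psi : {scalar mor x y}) :
  (forall p f, f \in piece x y p -> phi f = psi f) -> phi = psi.
Proof.
move=> E; apply: scalar_ext => f; have [s ->] := component_sum f.
rewrite !linear_sum; apply: eq_bigr => p _; exact: E (component_in f p).
Qed.

End Hom.

(** A linear map that shifts degrees by d carries the decomposition of f to a
    decomposition of its image, and decompositions are unique. *)
Lemma component_shift (C D : hgCat k G) (x y : C) (z w : D)
    (L : {linear mor x y -> mor z w}) (d : G) :
  (forall p f, f \in piece x y p -> L f \in piece z w (p + d)) ->
  forall f p, component (L f) (p + d) = L (component f p).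
Proof.
move=> LP f p; have [_ [t [ut c0 E]]] := componentP f.
have dP : decomp (L f) (fun q => L (component f (q - d))).
  split=> [q|]; first by have := LP _ _ (component_in f (q - d)); rewrite subrK.
  exists [seq q + d | q <- t]; split.
  - by rewrite map_inj_uniq//; exact: addIr.
  - move=> q qt; rewrite c0 ?linear0//; apply: contra qt => qt.
    by apply/mapP; exists (q - d); rewrite ?subrK.
  rewrite {1}E linear_sum big_map; apply: eq_bigr => q _.
  by rewrite addrK.
by rewrite (decomp_uniq (componentP _) dP) addrK.
Qed.

(** The component of f in a degree other than p is sent to a component of L f
    that vanishes, so it is zero by injectivity. *)
Lemma piece_reflect (C D : hgCat k G) (x y : C) (z w : D)
    (L : {linear mor x y -> mor z w}) (d : G) :
  injective L ->
  (forall p f, f \in piece x y p -> L f \in piece z w (p + d)) ->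
  forall p f, L f \in piece z w (p + d) -> f \in piece x y p.
Proof.
move=> Li LP p f Lf; apply: piece_component => q qp; apply: Li.
rewrite linear0 -(component_shift LP) (component_piece Lf).
by rewrite (can_eq (addrK d)) (negbTE qp).
Qed.

(** The component of g in degree - p is already a left inverse of f, because
    the identity has degree 0; a left inverse equals the inverse g. *)
Lemma homog_inverse (C : hgCat k G) (x y : C) (f : mor x y) (g : mor y x) p :
  f \in piece x y p -> mcomp g f = idm x -> mcomp f g = idm y ->
  g \in piece y x (- p).
Proof.
move=> fP gf fg.
have LP q (h : mor y x) : h \in piece y x q -> precomp f h \in piece x x (q + p).
  by move=> hP; exact: pieceM.
have : mcomp (component g (- p)) f = idm x.
  rewrite -[LHS]/(precomp f _) -(component_shift LP) addNr /= /precomp gf.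
  by rewrite (component_piece (piece1 x)) eqxx.
move=> /(congr1 (fun h => mcomp h g)).
rewrite -Defs.compA fg compm1 comp1m => <-; exact: component_in.
Qed.

End Homog.

(** * Fully faithful functors and autoequivalences *)

Section Equiv.
Variables (k : fieldType) (C : linCat k).

Definition fully_faithful (S : linFunctor C C) :=
  forall x y : C, bijective (@fmap k C C S x y).

Lemma invertible_monic (x y z : C) (g : mor y z) :
  invertible g -> injective (@mcomp k C x y z g).
Proof.
move=> [g' [g'g _]] f1 f2 /(congr1 (mcomp g')).
by rewrite !Defs.compA g'g !comp1m.
Qed.

Lemma invertible_epic (x y z : C) (f : mor x y) :
  invertible f -> injective (fun g : mor y z => mcomp g f).
Proof.
move=> [f' [_ ff']] g1 g2 /(congr1 (fun h => mcomp h f')).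
by rewrite -!Defs.compA ff' !compm1.
Qed.

Lemma inj_surj_bij (A B : Type) (f : A -> B) :
  injective f -> (forall b, exists a, f a = b) -> bijective f.
Proof.
move=> fi /choice[g gK]; exists g => // a; exact/fi/gK.
Qed.

(** The unit makes S faithful and the counit makes T faithful. For fullness,
    conjugate T h by the unit to get f with T (S f) = T h. *)
Lemma autoequivalence_fully_faithful (S : linFunctor C C) :
  is_autoequivalence S -> fully_faithful S.
Proof.
move=> [T [eta [eps [[etaN etaI] [epsN epsI]]]]] x y.
have Tinj (a b : C) : injective (@fmap k C C T a b).
  move=> g h E; apply: (invertible_epic (epsI a)).
  by rewrite -[LHS]epsN -[RHS]epsN /= E.
apply: inj_surj_bij => [f g E|h].
  apply: (invertible_monic (etaI y)).
  by rewrite [LHS]etaN [RHS]etaN /= E.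
have [e [ee' e'e]] := etaI y.
exists (mcomp e (mcomp (fmap T h) (eta x))).
apply: Tinj; apply: (invertible_epic (etaI x)).
by rewrite -[LHS]etaN Defs.compA e'e comp1m.
Qed.

(** The quasi-inverse T sends x to a chosen y with e : S y -> x invertible, and f
    to the preimage under S of f conjugated by these isomorphisms. The unit at x
    is the preimage of the inverse of e at S x, so that the triangle identity
    for S holds by construction. *)
Lemma fully_faithful_autoequivalence (S : linFunctor C C) :
  fully_faithful S ->
  (forall x, exists y, exists e : mor (S y) x, invertible e) ->
  is_autoequivalence S.
Proof.
move=> Sff Ses.
have full x y (h : mor (S x) (S y)) : exists f, fmap S f = h.
  by have [g _ gK] := Sff x y; exists (g h).
have Sinj x y : injective (@fmap k C C S x y) by exact: bij_inj.
pose T0 x := projT1 (cid (Ses x)).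
pose eps x : mor (S (T0 x)) x := projT1 (cid (projT2 (cid (Ses x)))).
have epsI x : invertible (eps x) := projT2 (cid (projT2 (cid (Ses x)))).
pose eps' x := projT1 (cid (epsI x)).
have eps'K x : mcomp (eps' x) (eps x) = idm _ := (projT2 (cid (epsI x))).1.
have epsK x : mcomp (eps x) (eps' x) = idm _ := (projT2 (cid (epsI x))).2.
pose pre x y h := projT1 (cid (full x y h)).
have preK x y h : fmap S (pre x y h) = h := projT2 (cid (full x y h)).
pose T1 x y (f : mor x y) : mor (T0 x) (T0 y) :=
  pre _ _ (mcomp (eps' y) (mcomp f (eps x))).
have T1l x y : linear (@T1 x y).
  move=> a f g; apply: Sinj.
  by rewrite preK (comp_linearl (eps x)) !linearP /= !preK.
have T11 x : T1 x x (idm x) = idm (T0 x).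
  by apply: Sinj; rewrite preK comp1m eps'K fmap1.
have T1M x y z (g : mor y z) (f : mor x y) :
    T1 _ _ (mcomp g f) = mcomp (T1 _ _ g) (T1 _ _ f).
  apply: Sinj; rewrite fmapM !preK -!Defs.compA; congr mcomp; congr mcomp.
  by rewrite Defs.compA epsK comp1m.
pose T := LinFunctor T1l T11 T1M.
pose eta x : mor x (T (S x)) := pre _ _ (eps' (S x)).
exists T, eta, eps; do 2!split.
- move=> x y f; apply: Sinj; rewrite !fmapM !preK -!Defs.compA.
  by rewrite epsK compm1.
- move=> x; exists (pre _ _ (eps (S x))).
  by split; apply: Sinj; rewrite fmapM !preK fmap1 ?epsK ?eps'K.
- by move=> x y f; rewrite /= preK Defs.compA epsK comp1m.
- exact: epsI.
Qed.
End Equiv.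

(** * The Serre structure on the smash product *)

Section Main.
Variables (k : fieldType) (G : zmodType) (C : hgCat k G) (S : hgFunctor C C).

Lemma smash_functor_fully_faithful :
  fully_faithful S -> fully_faithful (smash_functor S).
Proof.
move=> Sff X Y; have [T TK ST] := Sff X.1 Y.1.
have SP p (f : mor X.1 Y.1) : f \in piece X.1 Y.1 p ->
    fmap S f \in piece (S X.1) (S Y.1) (p + (adj S Y.1 - adj S X.1)).
  by move=> /(hgfun_deg S); rewrite addrA.
apply: inj_surj_bij => [f g /(congr1 val)/= E|h].
  by apply: val_inj; exact: (can_inj TK) E.
have TP : T (val h) \in piece X.1 Y.1 (Y.2 - X.2).
  apply: (piece_reflect (can_inj TK) SP); rewrite /= ST.
  by apply: piece_eq (hvalP h); rewrite /= -smash_degE addrA.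
by exists (Homog TP); apply: val_inj; exact: ST.
Qed.

(** Essential surjectivity: the counit at x is homogeneous with homogeneous
    inverse, so it becomes an isomorphism onto x^p once T x is placed in the
    position that its degree dictates. *)
Lemma smash_functor_autoequivalence :
  is_hg_autoequivalence S -> is_autoequivalence (smash_functor S).
Proof.
move=> [T [eta [eps [etaI epsI _ epsP]]]].
apply: fully_faithful_autoequivalence.
  apply/smash_functor_fully_faithful/autoequivalence_fully_faithful.
  by exists T, eta, eps.
move=> [x p]; have [d dP] := epsP x; have [g [ge eg]] := epsI.2 x.
have degE : d = p - (p - d - adj S (T x) + adj S (T x)).
  by rewrite subrK opprB addrC subrK.
have degNE : - d = (p - d - adj S (T x) + adj S (T x)) - p.
  by rewrite subrK addrAC subrr add0r.
(* smash_functor S moves this object to position p - d. *)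
exists (T x, p - d - adj S (T x)).
exists (Homog (piece_eq degE dP)).
exists (Homog (piece_eq degNE (homog_inverse dP ge eg))).
by split; apply: val_inj.
Qed.

Variables (chi : G -> k) (kappa : forall x y : C, mor x y -> {scalar mor y (S x)}).
Hypotheses (chiP : is_character chi) (kappaP : is_hg_serre chi kappa).

Lemma smash_kappaE (X Y : smash C) (f : mor X Y) (u : mor Y (smash_functor S X)) :
  smash_kappa chi kappa f u = chi (- Y.2) * kappa (hval f) (hval u).
Proof. by []. Qed.

(** Elements of degree n = q - p correspond under kappa to the functionals that
    vanish on the pieces of C(y, S x) of degree other than - (n - l x), which is
    the degree of the morphisms from y^q to the image of x^p. *)
Lemma smash_kappa_bij (X Y : smash C) :
  bijective (@smash_kappa k G C S chi kappa X Y).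
Proof.
have degE : - (Y.2 - X.2 - adj S X.1) = (X.2 + adj S X.1) - Y.2.
  by rewrite -addrA -opprD opprB.
apply: inj_surj_bij => [f g E|phi].
  apply: val_inj; apply: (hg_serre_inj kappaP).
  apply: scalar_piece_ext => r u uP.
  have [rE|rN] := eqVneq r (- (Y.2 - X.2 - adj S X.1)).
    have := congr1 (fun phi : {scalar _} =>
      phi (Homog (piece_eq (etrans rE degE) uP))) E.
    by apply: mulfI; exact: chiP.1.
  have vanish (h : mor X Y) : kappa (val h) u = 0.
    have [_ /(_ _)H] := hg_serre_im_deg kappaP (Y.2 - X.2) (kappa (val h)).
    by apply: (H _ r u rN uP); exists (val h) => //; exact: valP h.
  by rewrite !vanish.
(* The given functional is extended by zero along the projection onto the
   piece on which it lives. *)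
pose proj (u : mor Y.1 (S X.1)) : mor Y (smash_functor S X) :=
  Homog (component_in u (X.2 + adj S X.1 - Y.2)).
have projP (u : mor Y (smash_functor S X)) : proj (val u) = u.
  by apply: val_inj; rewrite /= (component_piece (valP u)) eqxx.
pose Phi0 u := (chi (- Y.2))^-1 * phi (proj u).
have Phi0L : scalar Phi0.
  move=> a u v; rewrite /Phi0.
  have -> : proj (a *: u + v) = a *: proj u + proj v.
    by apply: val_inj; exact: component_linear.
  by rewrite linearP mulrDr mulrCA.
pose PhiL := GRing.isLinear.Build k _ _ *%R Phi0 Phi0L.
pose Phi : {scalar mor Y.1 (S X.1)} := HB.pack Phi0 PhiL.
have [f fP fE] : exists2 f, f \in piece X.1 Y.1 (Y.2 - X.2) & kappa f = Phi.
  apply/(hg_serre_im_deg kappaP) => r u; rewrite degE => rN uP.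
  rewrite /Phi /= /Phi0 [proj u](_ : _ = 0) ?linear0 ?mulr0//.
  by apply: val_inj; rewrite /= (component_piece uP) eq_sym (negbTE rN).
exists (Homog fP); apply: scalar_ext => u.
rewrite !smash_kappaE fE /Phi /= /Phi0 projP mulVKf//.
exact: chiP.1.
Qed.

Lemma smash_is_serre : is_serre (smash_kappa chi kappa).
Proof.
split.
- exact/smash_functor_autoequivalence/(hg_serre_equiv kappaP).
- move=> X Y a f g u; rewrite !smash_kappaE.
  by rewrite (hg_serre_linear kappaP) mulrDr mulrCA.
- exact: smash_kappa_bij.
- move=> X Y Z h g u; rewrite !smash_kappaE.
  rewrite (hg_serre_left kappaP (valP h) (valP g) (valP u)) mulrA -chiP.2.
  by rewrite addrA addNr add0r.
- move=> X Y Z g f u; rewrite !smash_kappaE.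
  by rewrite (hg_serre_right kappaP (valP g) (valP f) (valP u)).
Qed.

Lemma smash_functor_shift (p : G) :
  functor_comp (smash_functor S) (smash_action C p) =
  functor_comp (smash_action C p) (smash_functor S).
Proof.
have e (X : smash C) : functor_comp (smash_functor S) (smash_action C p) X =
    functor_comp (smash_action C p) (smash_functor S) X.
  by rewrite /= addrAC.
apply: (functor_ext (e := e)) => -[x q] [y r] f.
by apply: val_inj; rewrite /= hval_cast.
Qed.

(** The identity transformation is a transport along an equality of objects that
    only rewrites the exponent, so the underlying morphism of C is an
    identity; the same holds for its inverse. *)
Lemma hval_smash_functor_shift p Y (e := smash_functor_shift p) :
  hval (id_transf e Y) = idm (S Y.1) /\
  hval (id_transf (esym e) Y) = idm (S Y.1).
Proof. by case: Y => y q; split; exact: hval_cast. Qed.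

(** The pairing at (F^p y, x) carries chi (- q), where x has exponent q, and the
    one at (y, F^-p x) carries chi (p - q); the factor chi (p)^-1 of zeta makes
    up the difference. *)
Lemma smash_is_zeta (p : G) :
  is_zeta (smash_kappa chi kappa) (actNK (smash_action C) p)
    (fun Y => (chi p)^-1 *: id_transf (smash_functor_shift p) Y).
Proof.
have [chi0 chiD] := chiP.
pose e := smash_functor_shift p.
have eE Y : hval (id_transf e Y) = idm (S Y.1).
  by case: (hval_smash_functor_shift p Y).
have eVE Y : hval (id_transf (esym e) Y) = idm (S Y.1).
  by case: (hval_smash_functor_shift p Y).
split; first split.
- move=> X Y f; apply: val_inj.
  rewrite /= mcompZl mcompZr !eE.
  by congr (_ *: _); rewrite [LHS]comp1m [RHS]compm1.
- move=> Y; exists (chi p *: id_transf (esym e) Y).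
  by split; apply: val_inj;
    rewrite /= mcompZl mcompZr scalerA ?mulfV ?mulVf// scale1r eE eVE
      [LHS]comp1m.
- move=> [x q] [y r] f u.
  rewrite !smash_kappaE !hval_cast /= mcompZl linearZ /= eE comp1m.
  by rewrite opprB chiD mulrACA mulfV// mul1r.
Qed.

End Main.

Theorem proposition4p33 (k : fieldType) (G : zmodType) (chi : G -> k)
    (C : hgCat k G) (S : hgFunctor C C)
    (kappa : forall x y : C, mor x y -> {scalar mor y (S x)}) :
  is_character chi ->
  fd_pieces C ->
  is_hg_serre chi kappa ->
  exists comm : forall p : G,
      functor_comp (smash_functor S) (smash_action C p) =
      functor_comp (smash_action C p) (smash_functor S),
    is_equivariant_serre chi (F := smash_action C) (S := smash_functor S)
      (fun p => id_transf (comm p))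
      (smash_kappa chi kappa).
Proof.
move=> chiP _ kappaP; exists (smash_functor_shift S).
split; first exact: smash_is_serre.
move=> p; exists (fun Y => (chi p)^-1 *: id_transf (smash_functor_shift S p) Y).
split; first exact: smash_is_zeta.
by move=> Y; rewrite scalerA mulfV ?scale1r//; exact: chiP.1.
Qed.
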